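(* The branching of the chain $\mathbb{C}[S_1]\subset\mathbb{C}[S_2]\subset\dots\subset\mathbb{C}[S_n]$ is simple; i.e. for each $n\ge 2$, every irreducible complex representation of $S_{n-1}$ occurs with multiplicity $0$ or $1$ in the restriction to $S_{n-1}$ of any irreducible complex representation of $S_n$.
   Context: $S_{n-1}\subset S_n$ is the stabilizer of $n$. *)

(* Defs.v *)
From HB Require Import structures.
From mathcomp Require Import all_boot all_order all_algebra.
From mathcomp Require Import all_fingroup all_solvable all_field all_character.
From mathcomp Require Import complex.
From mathcomp Require Import boolp reals.

Set Implicit Arguments.
Unset Strict Implicit.
Unset Printing Implicit Defensive.

Import GroupScope.

(* S_n embedded in S_(n+1) as the stabilizer of the last point; the points
   1, ..., n+1 are represented by 0, ..., n : 'I_n.+1. *)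
Definition sym_stab_last (n : nat) : {group 'S_n.+1} :=
  'C[ord_max : 'I_n.+1 | 'P]%G.

(* Restriction of a representation of the full group to a subgroup H. *)
Definition res_repr (F : fieldType) (gT : finGroupType) (H : {group gT})
    (d : nat) (rG : mx_representation F [set: gT] d) :
    mx_representation F H d :=
  subg_repr rG (subsetT H).

(* Multiplicity of the irreducible representation rU of H in rW.  The components
   of DecSocleType rW are the isotypic components of rW, each W being the direct
   sum of socle_mult W copies of socle_repr W.  Distinct components have
   non-isomorphic socle_repr, so the sum below has at most one term; it is empty
   when rU does not occur in rW. *)
Definition irr_mult (F : decFieldType) (gT : finGroupType) (H : {group gT})
    (dU dW : nat) (rU : mx_representation F H dU)
    (rW : mx_representation F H dW) : nat :=
  (\sum_(W : DecSocleType rW | `[< mx_rsim (socle_repr W) rU >])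
     socle_mult W)%N.

(* Main.v *)
Require Import Defs.
From mathcomp Require Import all_boot all_order all_algebra.
From mathcomp Require Import all_fingroup all_solvable all_field all_character.
From mathcomp Require Import complex.
From mathcomp Require Import boolp reals.

(** Every g in S_n is conjugate to g^-1 by an element of S_(n-1): write each
cycle of g starting from a base point, which is n for the cycle through n, and
reverse all cycles about their base points. Hence the sum of the
S_(n-1)-conjugates of g is invariant under the anti-automorphism
g |-> g^-1 of the group algebra, and any two such sums commute. If V is an
irreducible S_n-module, C[S_n] maps onto End V, and averaging shows that these
sums span the commutant of S_(n-1) in End V, which is therefore commutative.
Two distinct isomorphic simple S_(n-1)-submodules of V would yield
two non-commuting elements of the commutant: a projection onto the first one,
and this projection followed by an isomorphism with the second one. *)

Set Implicit Arguments.
Unset Strict Implicit.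
Unset Printing Implicit Defensive.

Section PermInverse.

Import GroupScope.

Variable T : finType.
Implicit Types (s : {perm T}) (x y : T).

Lemma permXN_eq s i j x : (s ^- i) x = (s ^- j) x -> (s ^+ i) x = (s ^+ j) x.
Proof.
move=> eq_ij; rewrite -{1}(permKV (s ^+ j) x) -{2}(permKV (s ^+ i) x) eq_ij.
by rewrite -!permM -!expgD addnC.
Qed.

Lemma perm_conj_inv_fix s x : exists2 h, h \in 'C[x | 'P] & s ^ h = s^-1.
Proof.
(* The base point depends only on the cycle of [y]. The cycle of [x] has base [x], so that its
   reversal fixes [x]; the default [x] is never reached, since orbits are nonempty. *)
pose base y :=
  if x \in porbit s y then x else odflt x [pick z in porbit s y].
have baseP y : base y \in porbit s y.
  rewrite /base; case: ifP => // _; case: pickP => //= /(_ y).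
  by rewrite porbit_id.
have eq_base y z : y \in porbit s z -> base y = base z.
  by rewrite -eq_porbit_mem /base => /eqP->.
have /fin_all_exists[e eP] y : exists i, y = (s ^+ i) (base y).
  by apply/porbitP; rewrite porbit_sym.
(* Reversal of each cycle about its base. The exponent [e y] is defined only modulo the cycle
   length; [permXN_eq] absorbs this ambiguity. *)
pose f y := (s ^- e y) (base y).
have base_f y : base (f y) = base y.
  rewrite (eq_base _ (base y)); last by rewrite -porbitV /f -expgVn mem_porbit.
  by apply: eq_base.
have f_inj : injective f.
  move=> y z eq_f; have eq_b: base y = base z by rewrite -base_f eq_f base_f.
  by rewrite (eP y) (eP z) -eq_b; apply: permXN_eq; rewrite -/(f y) eq_f eq_b.
pose h := perm f_inj.
have base_x : base x = x by rewrite /base porbit_id.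
exists h; first apply/astab1P.
  rewrite /= /aperm permE /f base_x.
  by apply: (@perm_inj _ (s ^+ e x)); rewrite permKV {1}(eP x) base_x.
have sh : s * h = h * s^-1.
  apply/permP=> y; rewrite !permM !(permE f_inj) /f.
  have eq_b : base (s y) = base y.
    by apply: eq_base; rewrite -{1}(expg1 s) mem_porbit.
  rewrite eq_b -permM -invMg -expgS -!expgVn; apply: permXN_eq.
  by rewrite -!expgVn !invgK -{1}eq_b -eP expgSr permM -eP.
by rewrite conjgE sh mulKg.
Qed.

End PermInverse.

Section CentralizerSums.

Import GroupScope GRing.Theory.
Local Open Scope ring_scope.

Variables (F : fieldType) (gT : finGroupType) (G H : {group gT}).
Hypothesis sHG : H \subset G.
Hypothesis conjV : forall g, g \in G -> exists2 h, h \in H & (g ^ h = g^-1)%g.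
Variables (n : nat) (rG : mx_representation F G n).

(** Summing over [H] rather than over the [H]-class of [g] repeats each conjugate equally often and
    makes every reindexing a translation in [H]. *)
Definition conj_sum (g : gT) : 'M[F]_n := \sum_(h in H) rG (g ^ h)%g.

Lemma conj_sumJ g h : h \in H -> conj_sum (g ^ h)%g = conj_sum g.
Proof.
move=> Hh; rewrite /conj_sum [RHS](reindex_inj (mulgI h)) /=.
by apply: eq_big => [k | k _]; rewrite ?groupMl // conjgM.
Qed.

Lemma conj_sumV g : g \in G -> conj_sum g^-1%g = conj_sum g.
Proof. by case/conjV=> h Hh <-; apply: conj_sumJ. Qed.

Lemma conj_sumMl a b : a \in G -> b \in G ->
  conj_sum a *m conj_sum b = \sum_(h in H) conj_sum (a * b ^ h)%g.
Proof.
move=> Ga Gb; rewrite mulmx_suml [RHS]exchange_big /=.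
apply: eq_bigr => h Hh.
rewrite mulmx_sumr [LHS](reindex_acts 'R _ Hh) ?astabsR //=.
apply: eq_bigr => k Hk; have [Gh Gk] := (subsetP sHG _ Hh, subsetP sHG _ Hk).
by rewrite -repr_mxM ?groupJ ?groupM // conjMg conjgM.
Qed.

Lemma conj_sumMr a b : a \in G -> b \in G ->
  conj_sum a *m conj_sum b = \sum_(h in H) conj_sum (a ^ h * b)%g.
Proof.
move=> Ga Gb; rewrite conj_sumMl // (reindex_inj invg_inj) /=.
apply: eq_big => h; rewrite ?groupV // => Hh.
by rewrite -(conj_sumJ _ Hh) conjMg conjgKV.
Qed.

(** Gelfand's trick: inverting [a * b ^ h] swaps the factors, while [conj_sum] does not see
    inversion. *)
Lemma conj_sumC a b : a \in G -> b \in G ->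
  conj_sum a *m conj_sum b = conj_sum b *m conj_sum a.
Proof.
move=> Ga Gb; rewrite conj_sumMl // -(conj_sumV Gb) -(conj_sumV Ga).
rewrite conj_sumMr ?groupV //; apply: eq_bigr => h /(subsetP sHG) Gh.
by rewrite conjVg -invMg conj_sumV // groupM ?groupJ.
Qed.

(** Absolute irreducibility makes [A] a combination of the [rG g]; conjugating by all of [H] fixes
    [A] and turns each [rG g] into [conj_sum g]. Keeping the factor [#|H|] avoids a division
    here. *)
Lemma centgmx_conj_sum A :
    mx_absolutely_irreducible rG -> centgmx (subg_repr rG sHG) A ->
  exists a, #|H|%:R *: A = \sum_(g in G) a g *: conj_sum g.
Proof.
case/mx_abs_irrP=> _ [a_ defM] /centgmxP cAH; exists (a_^~ A).
transitivity (\sum_(h in H) rG h^-1%g *m A *m rG h).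
  rewrite scaler_nat -sumr_const; apply: eq_bigr => h Hh.
  have Gh := subsetP sHG _ Hh.
  by rewrite -mulmxA (cAH h Hh) mulmxA -repr_mxM ?groupV // mulVg repr_mx1 mul1mx.
under eq_bigr => h Hh do rewrite [A in _ *m A *m _]defM mulmx_sumr mulmx_suml.
rewrite exchange_big; apply: eq_bigr => g Gg; rewrite scaler_sumr.
apply: eq_bigr => h Hh; have Gh := subsetP sHG _ Hh.
by rewrite -scalemxAr -scalemxAl -!repr_mxM ?groupM ?groupV // conjgE mulgA.
Qed.

Lemma centgmx_subg_comm A B :
    mx_absolutely_irreducible rG -> ([pchar F]^').-group H ->
    centgmx (subg_repr rG sHG) A -> centgmx (subg_repr rG sHG) B ->
  A *m B = B *m A.
Proof.
move=> absG; rewrite /pgroup pcharf'_nat => nzH.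
move=> /(centgmx_conj_sum absG)[a defA] /(centgmx_conj_sum absG)[b defB].
apply: (scalerI nzH); apply: (scalerI nzH); rewrite [in LHS]scalemxAr.
rewrite [LHS]scalemxAl [in RHS]scalemxAl [RHS]scalemxAr defA defB.
rewrite mulmx_suml mulmx_sumr; apply: eq_bigr => g Gg.
rewrite mulmx_sumr mulmx_suml; apply: eq_bigr => k Gk.
by rewrite -!scalemxAl -!scalemxAr !scalerA mulrC conj_sumC.
Qed.

End CentralizerSums.

Section MultiplicityFree.

Import GRing.Theory.
Local Open Scope ring_scope.

(** Schur's lemma: an endomorphism minus one of its eigenvalues is singular, hence zero. *)
Lemma closed_mx_irr_abs (F : closedFieldType) (gT : finGroupType)
    (G : {group gT}) (n : nat) (rG : mx_representation F G n) :
  mx_irreducible rG -> mx_absolutely_irreducible rG.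
Proof.
move=> irrG; have [n_gt0 _] := (mx_irrP rG).1 irrG.
apply: cent_mx_scalar_abs_irr => //; rewrite leqNgt.
apply/(has_non_scalar_mxP (scalar_mx_cent _ _)) => -[A].
rewrite memmx_cent_envelop => cGA /negP[].
have [a] : exists a, root (char_poly A) a.
  by apply: closed_rootP; rewrite size_char_poly; case: (n) n_gt0.
rewrite -eigenvalue_root_char => /eigenvalueP[v vA nz_v].
have cGAa : centgmx rG (A - a%:M).
  rewrite -memmx_cent_envelop linearB addmx_sub ?eqmx_opp ?scalar_mx_cent //=.
  by rewrite memmx_cent_envelop.
have [/eqP | /(mx_Schur irrG cGAa) uAa] := eqVneq (A - a%:M) 0.
  by rewrite subr_eq0 => /eqP->; apply: scalar_mx_is_scalar.
case/eqP: nz_v; rewrite -[v](mulmxK uAa) mulmxBr vA mul_mx_scalar subrr.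
exact: mul0mx.
Qed.

Variables (F : decFieldType) (gT : finGroupType) (G : {group gT}).
Variables (n : nat) (rG : mx_representation F G n).
Hypothesis redG : mx_completely_reducible rG 1%:M.
Hypothesis centC :
  forall A B, centgmx rG A -> centgmx rG B -> A *m B = B *m A.

Lemma component_mx_cent_comm U :
  mxsimple rG U -> (\rank (component_mx rG U) <= \rank U)%N.
Proof.
move=> simU; have [modU nzU _] := simU; set C := component_mx rG U.
have [K modK defUK /mxdirect_addsP dxUK] := redG modU (submx1 U).
rewrite leqNgt; apply/negP=> ltUC.
(* By dimension, a component larger than [U] must meet the complement [K], which yields a second
   copy [V] of [U] inside [K]. *)
have nzCK : (C :&: K)%MS != 0.
  apply: contraTneq ltUC => dxCK; rewrite -leqNgt -(leq_add2r (\rank K)).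
  rewrite -(mxrank_disjoint_sum dxCK) -(mxrank_disjoint_sum dxUK) defUK mxrank1.
  exact: rank_leq_row.
have modC : mxmodule rG C by apply: component_mx_module.
have [V simV] := dec_mxsimple_exists (capmx_module modC modK) nzCK.
rewrite sub_capmx => /andP[sVC sVK]; have [_ nzV _] := simV.
have [f _ homUf defV] := component_mx_iso simU simV sVC.
pose p := proj_mx U K.
have cGp : centgmx rG p.
  by rewrite -row_full_dom_hom -sub1mx -defUK proj_mx_hom.
have cGpf : centgmx rG (p *m f).
  apply/centgmxP=> x Gx; have sp : (p <= dom_hom_mx rG f)%MS.
    by apply: submx_trans homUf; rewrite -[p]mul1mx proj_mx_sub.
  by rewrite -(hom_mxP sp) ?(centgmxP cGp) ?[RHS]mulmxA.
(* Matrices act on row vectors, so [p] comes first: [p *m (p *m f)] is [p *m f], whereas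
   [(p *m f) *m p] vanishes because [f] sends [U] into [K]. *)
have pf0 : p *m f = 0.
  have sfK : (p *m f <= K)%MS.
    apply: submx_trans sVK; rewrite -defV submxMr //.
    by rewrite -[p]mul1mx proj_mx_sub.
  have := centC cGp cGpf; rewrite mulmxA proj_mx_proj // => ->.
  exact: proj_mx_0.
case/eqP: nzV; apply/eqP; rewrite -submx0 -defV.
by rewrite -[U](proj_mx_id dxUK (submx_refl U)) -mulmxA pf0 mulmx0.
Qed.

Lemma socle_mult_cent_comm (sG : socleType rG) (W : sG) : socle_mult W = 1%N.
Proof.
have simW := socle_simple W; have [_ nzW _] := simW.
have rW : \rank W = \rank (socle_base W).
  apply/eqP; rewrite eqn_leq component_mx_cent_comm //.
  by rewrite mxrankS ?component_mx_id.
by rewrite /socle_mult rW divnn lt0n mxrank_eq0 nzW.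
Qed.

End MultiplicityFree.

Theorem theorem2p9 (R : realType) (n : nat) (hn : 0 < n)
    (dU : nat) (rU : mx_representation R[i] (sym_stab_last n) dU)
    (dV : nat) (rV : mx_representation R[i] [set: 'S_n.+1] dV)
    (hU : mx_irreducible rU) (hV : mx_irreducible rV) :
  irr_mult rU (res_repr (sym_stab_last n) rV) = 0 \/
  irr_mult rU (res_repr (sym_stab_last n) rV) = 1.
Proof.
set H := sym_stab_last n; set rH := res_repr H rV.
have conjV g : g \in [set: 'S_n.+1] -> exists2 h, h \in H & (g ^ h = g^-1)%g.
  by move=> _; apply: perm_conj_inv_fix.
have pcharH : (([pchar R[i]]%R^').-group H)%g.
  by rewrite /pgroup GRing.Theory.pcharf'_nat Num.Theory.pnatr_eq0 -lt0n cardG_gt0.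
have mult1 (W : DecSocleType rH) : socle_mult W = 1.
  apply: socle_mult_cent_comm => [|A B]; first exact: mx_Maschke_pchar.
  exact: centgmx_subg_comm (closed_mx_irr_abs hV) pcharH.
rewrite /irr_mult; case: (pickP (fun W : DecSocleType rH =>
  `[< mx_rsim (socle_repr W) rU >])) => [W /asboolP simW | noW].
  right; rewrite (big_pred1 W) // => W' /=; apply/asboolP/socle_rsimP => simW'.
    exact: mx_rsim_trans simW' (mx_rsim_sym simW).
  exact: mx_rsim_trans simW' simW.
by left; rewrite big_pred0.
Qed.
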